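(* Let $p$ be an odd prime, $q=p^n$ with $n\in\mathbb N$, and let $w\in\mathbb F_q$ be such that $q\equiv1\pmod 4$ and $w^2=-1$. Let $\mathbb P^2=\{(\boldsymbol\xi,\tau)\in\mathbb F_q^2\times\mathbb F_q:\tau=\boldsymbol\xi\cdot\boldsymbol\xi\}$ be equipped with its normalized surface measure $\sigma$. Then $f:\mathbb P^2\to\mathbb C$ is a maximizer of the sharp inequality $$\|(f\sigma)^\vee\|_{L^4(\mathbb F_q^3,\mathrm d\boldsymbol x)}^4\le\left(1+\frac1q-\frac1{q^2}\right)\|f\|_{L^2(\mathbb P^2,\mathrm d\sigma)}^4$$ if and only if there exist $\lambda\in\mathbb C\setminus\{0\}$ and $a,b,c\in\mathbb F_q$ such that, for all $\eta,\zeta\in\mathbb F_q$, $$f(\eta(1,w)+\zeta(1,-w))=\lambda\exp\frac{2\pi i\,\mathrm{Tr}_n(a\eta+b\zeta+c\eta\zeta)}{p}.$$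
   Context: A function $f:\mathbb P^2\to\mathbb C$ is identified with its projection $f:\mathbb F_q^2\to\mathbb C$, $f(\boldsymbol\xi)=f(\boldsymbol\xi,\boldsymbol\xi\cdot\boldsymbol\xi)$; every $\boldsymbol\xi\in\mathbb F_q^2$ is uniquely written as $\eta(1,w)+\zeta(1,-w)$ with $\eta,\zeta\in\mathbb F_q$. The trace map $\mathrm{Tr}_n:\mathbb F_q\to\mathbb F_p$ is $\mathrm{Tr}_n(x)=x+x^p+\dots+x^{p^{n-1}}$. $\mathbb F_q$ is the finite field with $q$ elements and $e:\mathbb F_q\to\mathbb S^1\subset\mathbb C$ is a fixed nontrivial additive character. For $\boldsymbol x,\boldsymbol\xi\in\mathbb F_q^d$, $\boldsymbol x\cdot\boldsymbol\xi=\sum_i x_i\xi_i$. For a nonempty set $S\subset\mathbb F_q^d$ with normalized surface measure $\sigma$ (uniform probability measure on $S$) and $f:S\to\mathbb C$, the extension operator is $(f\sigma)^\vee(\boldsymbol x)=\frac1{|S|}\sum_{\boldsymbol\xi\in S}f(\boldsymbol\xi)e(\boldsymbol x\cdot\boldsymbol\xi)$, $\boldsymbol x\in\mathbb F_q^d$. Norms: $\|f\|_{L^r(S,\mathrm d\sigma)}=\big(\frac1{|S|}\sum_{\boldsymbol\xi\in S}|f(\boldsymbol\xi)|^r\big)^{1/r}$ and $\|g\|_{L^r(\mathbb F_q^d,\mathrm d\boldsymbol x)}=\big(\sum_{\boldsymbol x\in\mathbb F_q^d}|g(\boldsymbol x)|^r\big)^{1/r}$. A maximizer is a not identically zero function $f:S\to\mathbb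 C$ for which equality holds in the inequality with best constant. *)

(* Defs.v *)
From HB Require Import structures.
From mathcomp Require Import all_boot all_order all_algebra all_field.
From mathcomp Require Import complex zify.
From mathcomp Require Import boolp reals sequences exp trigo.

Set Implicit Arguments.
Unset Strict Implicit.
Unset Printing Implicit Defensive.

Import Order.TTheory GRing.Theory Num.Theory.
Local Open Scope ring_scope.
Local Open Scope complex_scope.

Section ComplexNumbers.
Variable R : realType.

Definition cnorm (z : R[i]) : R := complex.Re `|z|.

Definition cexp (z : R[i]) : R[i] :=
  (expR (complex.Re z))%:C * (cos (complex.Im z) +i* sin (complex.Im z)).

End ComplexNumbers.

Section Extension.
Variables (R : realType) (F : finFieldType).

Definition nontrivial_additive_character (e : F -> R[i]) : Prop :=
  [/\ forall x y, e (x + y) = e x * e y,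
      forall x, cnorm (e x) = 1
    & exists x, e x != 1].

Definition dot d (x y : 'rV[F]_d) : F := \sum_(i < d) x 0 i * y 0 i.

Definition sfun d (S : {set 'rV[F]_d}) := {xi : 'rV[F]_d | xi \in S} -> R[i].

Definition extension d (e : F -> R[i]) (S : {set 'rV[F]_d}) (f : sfun S)
    (x : 'rV[F]_d) : R[i] :=
  #|S|%:R^-1 * \sum_(xi : {xi | xi \in S}) f xi * e (dot x (val xi)).

Definition Lnorm_surface d (S : {set 'rV[F]_d}) (r : R) (f : sfun S) : R :=
  (#|S|%:R^-1 * \sum_(xi : {xi | xi \in S}) cnorm (f xi) `^ r) `^ r^-1.

Definition Lnorm_space d (r : R) (g : 'rV[F]_d -> R[i]) : R :=
  (\sum_(x : 'rV[F]_d) cnorm (g x) `^ r) `^ r^-1.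

Section Maximizers.
Variables (d : nat) (e : F -> R[i]) (S : {set 'rV[F]_d}).

Definition extension_ineq_24 (C : R) : Prop := forall f : sfun S,
  Lnorm_space 4 (extension e f) ^+ 4 <= C * Lnorm_surface 2 f ^+ 4.

Definition best_constant_24 (C : R) : Prop :=
  extension_ineq_24 C /\ forall C', extension_ineq_24 C' -> C <= C'.

Definition maximizer_24 (f : sfun S) : Prop :=
  (exists xi, f xi != 0) /\
  exists2 C, best_constant_24 C
    & Lnorm_space 4 (extension e f) ^+ 4 = C * Lnorm_surface 2 f ^+ 4.

End Maximizers.

End Extension.

Section Paraboloid.
Variable F : finFieldType.

(* Points of F^2 x F are row vectors of length 2 + 1. *)
Definition paraboloid : {set 'rV[F]_(2 + 1)} :=
  [set v | rsubmx v 0 0 == dot (lsubmx v) (lsubmx v)].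

Definition paraboloid_pt (xi : 'rV[F]_2) : 'rV[F]_(2 + 1) :=
  row_mx xi (\row_(j < 1) dot xi xi).

Lemma paraboloid_ptP xi : paraboloid_pt xi \in paraboloid.
Proof. by rewrite inE /paraboloid_pt row_mxKl row_mxKr mxE. Qed.

Definition proj (R : realType) (f : sfun R paraboloid) (xi : 'rV[F]_2) : R[i] :=
  f (exist _ (paraboloid_pt xi) (paraboloid_ptP xi)).

Definition vec2 (a b : F) : 'rV[F]_2 := \row_(j < 2) [:: a; b]`_j.

End Paraboloid.

Section Trace.
Variables (F : finFieldType) (p n : nat).

(* The sum lies in the prime subfield of F, which is identified with 'F_p
   through k |-> k%:R; the default value is never used (trace_natr). *)
Definition trace (x : F) : 'F_p :=
  odflt 0 [pick k : 'F_p | (k : nat)%:R == \sum_(i < n) x ^+ (p ^ i)].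

Hypotheses (p_prime : prime p) (cardF : #|F| = (p ^ n)%N).

Let pcharF : p \in [pchar F] := card_finPcharP cardF p_prime.

Lemma trace_natr (x : F) : (trace x : nat)%:R = \sum_(i < n) x ^+ (p ^ i).
Proof.
set y := \sum_(i < n) _.
have yp : y ^+ p = y.
  rewrite -(pFrobenius_autE pcharF) rmorph_sum /=.
  under eq_bigr do rewrite pFrobenius_autE -exprM -expnSr.
  rewrite /y; case: n cardF => [|m] cF; first by rewrite !big_ord0.
  rewrite big_ord_recr big_ord_recl /= -cF expf_card addrC expn0 expr1.
  by congr (_ + _); apply: eq_bigr.
rewrite /trace; case: pickP => [k /eqP //|no].
have inj : {in iota 0 p &, injective (fun k : nat => k%:R : F)}.
  move=> k l; rewrite !mem_iota !add0n /= => kp lp.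
  wlog kl : k l kp lp / (k <= l)%N.
    by move=> H; case/orP: (leq_total k l) => ? ?; [|symmetry]; apply: H.
  move=> /eqP; rewrite eq_sym -subr_eq0 -natrB // -(dvdn_pcharf pcharF).
  have [lk0 _|lk] := posnP (l - k); first by lia.
  by move=> /(dvdn_leq lk); lia.
pose s : seq F := y :: [seq k%:R | k <- iota 0 p].
have us : uniq s.
  rewrite /= map_inj_in_uniq // iota_uniq andbT.
  apply/negP => /mapP[k]; rewrite mem_iota add0n /= => kp yk.
  by have := no (inord k); rewrite inordK ?Fp_cast // -yk eqxx.
have P0 : 'X^p - 'X != 0 :> {poly F}.
  by rewrite -size_poly_gt0 size_polyDl size_polyXn // size_polyN size_polyX ltnS prime_gt1.
have rs : all (root ('X^p - 'X)) s.
  apply/allP => z; rewrite inE => /orP[/eqP ->|/mapP[k _ ->]].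
    by rewrite rootE !hornerE yp subrr.
  by rewrite rootE !hornerE -(pFrobenius_autE pcharF) rmorph_nat subrr.
have := max_poly_roots P0 rs us.
rewrite size_polyDl size_polyXn ?size_polyN ?size_polyX ?ltnS ?prime_gt1 //=.
by rewrite size_map size_iota ltnn.
Qed.

End Trace.

(* Main.v *)
Require Import Defs.
From HB Require Import structures.
From mathcomp Require Import all_boot all_order all_algebra all_field.
From mathcomp Require Import complex.
From mathcomp Require Import boolp reals sequences exp trigo.
From mathcomp Require Import ring lra.

Set Implicit Arguments.
Unset Strict Implicit.
Unset Printing Implicit Defensive.

Import Order.TTheory GRing.Theory Num.Theory.
Local Open Scope ring_scope.
Local Open Scope complex_scope.

(** In the null coordinates (eta, zeta) the paraboloid is the graph of
    4 * eta * zeta.  Expanding the square of the extension and applying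
    Plancherel turns the fourth power of its L^4 norm into
    q^-5 * sum_{m, k} |sum_{u.1 u.2 = k} phi (m + u) phi (m - u)|^2.  On the
    q - 1 points of a nondegenerate hyperbola Cauchy-Schwarz is sharp enough.
    The cross k = 0 is split into its centre and its two punctured arms:
    Cauchy-Schwarz on each arm again costs q - 1, and the products of the two
    arms and the centre sum to at most (sum |phi|^2)^2 by AM-GM.  What remains is
    sum |phi|^4 >= q^-2 (sum |phi|^2)^2, with equality iff |phi| is constant.
    A maximizer therefore has constant modulus, and phi (m + u) phi (m - u)
    depends only on m and u.1 u.2.  Degenerate u make phi, up to its restrictions
    to the axes, bimultiplicative, and m = 0 shows that this bimultiplicative
    part is a character of eta * zeta. *)

(** * Cauchy-Schwarz against the constant function, with its defect written as a sum of squares *)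

Lemma sum_sqr_diff (R : comNzRingType) (I : finType) (P : pred I) (a : I -> R) :
  \sum_(i | P i) \sum_(j | P j) (a i - a j) ^+ 2 =
  2 * (#|P|%:R * \sum_(i | P i) a i ^+ 2 - (\sum_(i | P i) a i) ^+ 2).
Proof.
set A := \sum_(i | P i) a i; set B := \sum_(i | P i) a i ^+ 2.
have E i : \sum_(j | P j) (a i - a j) ^+ 2 =
    #|P|%:R * a i ^+ 2 - 2 * A * a i + B.
  rewrite (eq_bigr (fun j => a i ^+ 2 + (- (2 * a i) * a j + a j ^+ 2))); last first.
    by move=> j _; ring.
  rewrite !big_split /= sumr_const -mulr_sumr -/A -/B -mulr_natl.
  by ring.
rewrite (eq_bigr _ (fun i _ => E i)) !big_split /= sumrN sumr_const -!mulr_sumr.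
rewrite -/A -/B -[B *+ _]mulr_natl; ring.
Qed.

Lemma sqr_sum_le (R : realFieldType) (I : finType) (P : pred I) (a : I -> R) :
  (\sum_(i | P i) a i) ^+ 2 <= #|P|%:R * \sum_(i | P i) a i ^+ 2.
Proof.
have: 0 <= \sum_(i | P i) \sum_(j | P j) (a i - a j) ^+ 2.
  by apply: sumr_ge0 => i _; apply: sumr_ge0 => j _; apply: sqr_ge0.
by rewrite sum_sqr_diff; lra.
Qed.

Lemma sqr_sum_eq_const (R : realFieldType) (I : finType) (a : I -> R) :
  (\sum_i a i) ^+ 2 = #|I|%:R * \sum_i a i ^+ 2 -> forall i j, a i = a j.
Proof.
move=> E i j; have := sum_sqr_diff predT a; rewrite -E subrr mulr0 => /eqP.
rewrite psumr_eq0 => [/allP /(_ i (mem_index_enum i)) /=|k _]; last first.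
  by apply: sumr_ge0 => l _; apply: sqr_ge0.
rewrite psumr_eq0 => [/allP /(_ j (mem_index_enum j)) /=|l _]; last exact: sqr_ge0.
by rewrite sqrf_eq0 subr_eq0 => /eqP.
Qed.

(** * Midpoint coordinates on pairs of points, and hyperbolas in the plane *)

Section Plane.
Variable F : finFieldType.
Hypothesis two_neq0 : 2 != 0 :> F.
Implicit Types m u v : F * F.

Lemma double_inj : injective (fun x : F => x + x).
Proof.
have E x : x + x = 2 * x :> F by ring.
by move=> x y; rewrite !E => /(mulfI two_neq0).
Qed.

(** As 2 is invertible, a pair of points is determined by its midpoint and half-difference.
    Injectivity of [(m, u) |-> (m + u, m - u)] suffices on a finite type. *)
Lemma sum_midpoint (V : nmodType) (h : F * F -> F * F -> V) :
  \sum_x \sum_y h x y = \sum_(m : F * F) \sum_(u : F * F) h (m + u) (m - u).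
Proof.
rewrite !pair_big /= (reindex_inj (h := fun p : (F * F) * (F * F) => (p.1 + p.2, p.1 - p.2))) //=.
move=> [[a b] [c d]] [[a' b'] [c' d']] /= [e1 e2 e3 e4].
have ea : a = a'.
  apply: double_inj; rewrite /= -[a + a](_ : (a + c) + (a - c) = _); last by ring.
  by rewrite e1 e3; ring.
have eb : b = b'.
  apply: double_inj; rewrite /= -[b + b](_ : (b + d) + (b - d) = _); last by ring.
  by rewrite e2 e4; ring.
by move: e1 e2; rewrite ea eb => /addrI -> /addrI ->.
Qed.

Lemma sum_fiber (V : nmodType) (k : F) (h : F * F -> V) :
  \sum_(u | u.1 * u.2 == k) h u = \sum_x \sum_(y | x * y == k) h (x, y).
Proof. by rewrite pair_big_dep /=; apply: eq_bigr => -[]. Qed.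

Lemma sum_hyperbola (V : nmodType) (k : F) (h : F * F -> V) : k != 0 ->
  \sum_(u | u.1 * u.2 == k) h u = \sum_(x | x != 0) h (x, k / x).
Proof.
move=> k0; rewrite sum_fiber.
rewrite (bigD1 0) //= big1 ?add0r => [|y]; last by rewrite mul0r eq_sym (negPf k0).
apply: eq_bigr => x x0; rewrite (big_pred1 (k / x)) // => y /=.
by rewrite eq_sym mulrC -[RHS](inj_eq (mulIf x0)) divfK // eq_sym.
Qed.

Lemma sum_cross (V : nmodType) (h : F * F -> V) :
  \sum_(u | u.1 * u.2 == 0) h u =
  h 0 + \sum_(x | x != 0) h (x, 0) + \sum_(y | y != 0) h (0, y).
Proof.
rewrite sum_fiber (bigD1 0) //= (eq_bigl predT) => [|y]; last by rewrite mul0r eqxx.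
rewrite (bigD1 0) //= -!addrA; congr (_ + _); rewrite addrC; congr (_ + _).
apply: eq_bigr => x x0; rewrite (big_pred1 0) // => y /=.
by rewrite mulf_eq0 (negPf x0).
Qed.

Lemma card_nonzero : #|[pred x : F | x != 0]| = #|F|.-1.
Proof. by rewrite -(cardC1 (0 : F)); apply: eq_card => x; rewrite !inE. Qed.

Lemma natr_card_nonzero (R : nzRingType) :
  #|[pred x : F | x != 0]|%:R = #|F|%:R - 1 :> R.
Proof.
rewrite card_nonzero; have: (0 < #|F|)%N by apply/card_gt0P; exists 0.
by case: #|F| => // n _; rewrite -natr1 addrK.
Qed.

(** * The energy inequality for nonnegative functions *)

Section Energy.
Variables (R : realFieldType) (g : F * F -> R).
Hypothesis g_ge0 : forall u, 0 <= g u.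
Let q : R := #|F|%:R.
Let w m u := g (m + u) * g (m - u).
Let H m := \sum_x w m (x, 0).
Let V m := \sum_y w m (0, y).

(* Keeping the centre of the cross out of Cauchy-Schwarz is what yields the term
   [q * g m ^+ 4], hence the constant [q + 1 - 1 / q] instead of [q + 1]. *)
Lemma fiber_sum_sqr_le m :
  \sum_k (\sum_(u | u.1 * u.2 == k) w m u) ^+ 2 + q * g m ^+ 4 <=
  (q - 1) * (\sum_u w m u ^+ 2) + 2 * (H m * V m).
Proof.
have -> : \sum_u w m u ^+ 2 = \sum_k \sum_(u | u.1 * u.2 == k) w m u ^+ 2.
  by rewrite (partition_big (fun u => u.1 * u.2) predT).
rewrite (bigD1 0) //= [X in _ <= (_ - _) * X + _](bigD1 0) //=.
have K : \sum_(k | k != 0) (\sum_(u | u.1 * u.2 == k) w m u) ^+ 2 <=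
    (q - 1) * \sum_(k | k != 0) \sum_(u | u.1 * u.2 == k) w m u ^+ 2.
  rewrite mulr_sumr; apply: ler_sum => k k0; rewrite !sum_hyperbola // -natr_card_nonzero.
  exact: sqr_sum_le.
rewrite !sum_cross.
have w0 : w m 0 = g m ^+ 2 by rewrite /w addr0 subr0.
have -> : H m = w m 0 + \sum_(x | x != 0) w m (x, 0) by rewrite /H (bigD1 0).
have -> : V m = w m 0 + \sum_(x | x != 0) w m (0, x) by rewrite /V (bigD1 0).
have := sqr_sum_le (fun x : F => x != 0) (fun x => w m (x, 0)).
have := sqr_sum_le (fun x : F => x != 0) (fun x => w m (0, x)).
rewrite natr_card_nonzero -/q w0; move: K.
set K1 := \sum_(k | k != 0) _; set K2 := \sum_(k | k != 0) _.
set X1 := \sum_(x | x != 0) _; set X2 := \sum_(x | x != 0) _.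
set Y1 := \sum_(x | x != 0) _; set Y2 := \sum_(x | x != 0) _.
(* With centre [c = g m ^+ 2] and arm sums [X], [Y], the identity is [(c + X + Y)^2 = X^2 + Y^2 + 2
   (c + X) (c + Y) - c^2], where [c + X = H m] and [c + Y = V m]. *)
lra.
Qed.

(** AM-GM bounds [H m] by the mass of the horizontal line through [m], and [V m] by that of the
    vertical one. The first bound depends only on [m.2] and the second only on [m.1], so the sum
    over [m] factors into two copies of the total mass. *)
Lemma sum_axes_le : \sum_m H m * V m <= (\sum_u g u ^+ 2) ^+ 2.
Proof.
have AG a b : a * b <= (a ^+ 2 + b ^+ 2) / 2 :> R.
  by have := sqr_ge0 (a - b); nra.
have line (r : F -> R) (c : F) :
    \sum_x r (c + x) * r (c - x) <= \sum_x r x ^+ 2.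
  apply: (@le_trans _ _ (\sum_x (r (c + x) ^+ 2 + r (c - x) ^+ 2) / 2)).
    by apply: ler_sum => x _; apply: AG.
  rewrite -mulr_suml big_split /=.
  have -> : \sum_x r (c + x) ^+ 2 = \sum_x r x ^+ 2.
    by rewrite [RHS](reindex_inj (addrI c)).
  have -> : \sum_x r (c - x) ^+ 2 = \sum_x r x ^+ 2.
    by rewrite [RHS](reindex_inj (inj_comp (addrI c) oppr_inj)).
  by lra.
have HE m : H m <= \sum_x g (x, m.2) ^+ 2.
  apply: le_trans (line (fun x => g (x, m.2)) m.1); apply: ler_sum => x _.
  have -> : w m (x, 0) = g (m.1 + x, m.2 + 0) * g (m.1 - x, m.2 - 0) by [].
  by rewrite addr0 subr0.
have VE m : V m <= \sum_y g (m.1, y) ^+ 2.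
  apply: le_trans (line (fun y => g (m.1, y)) m.2); apply: ler_sum => y _.
  have -> : w m (0, y) = g (m.1 + 0, m.2 + y) * g (m.1 - 0, m.2 - y) by [].
  by rewrite addr0 subr0.
have w_ge0 m u : 0 <= w m u by apply: mulr_ge0.
apply: (@le_trans _ _ (\sum_m (\sum_x g (x, m.2) ^+ 2) * \sum_y g (m.1, y) ^+ 2)).
  by apply: ler_sum => m _; apply: ler_pM => //; apply: sumr_ge0.
rewrite -(pair_big predT predT (fun x y => (\sum_x0 g (x0, y) ^+ 2) * \sum_y0 g (x, y0) ^+ 2)) /=.
under eq_bigr => x _ do rewrite -mulr_suml.
rewrite -mulr_sumr.
have -> : \sum_u g u ^+ 2 = \sum_x \sum_y g (x, y) ^+ 2.
  by rewrite pair_big /=; apply: eq_bigr => -[].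
by rewrite [X in X * _]exchange_big.
Qed.

Lemma energy_le :
  \sum_(m : F * F) \sum_k (\sum_(u | u.1 * u.2 == k) g (m + u) * g (m - u)) ^+ 2
    + q * \sum_u g u ^+ 4 <= (q + 1) * (\sum_u g u ^+ 2) ^+ 2.
Proof.
(* The squared mass is spread over midpoints, so the fibre bounds can be summed; the coefficients
   then add up as [(q - 1) + 2 = q + 1]. *)
have sq : (\sum_u g u ^+ 2) ^+ 2 = \sum_m \sum_u w m u ^+ 2.
  rewrite expr2 mulr_suml; under eq_bigr do rewrite mulr_sumr.
  rewrite sum_midpoint; apply: eq_bigr => m _; apply: eq_bigr => u _.
  by rewrite /w exprMn.
rewrite mulr_sumr -big_split /=.
apply: (@le_trans _ _ (\sum_m ((q - 1) * (\sum_u w m u ^+ 2) + 2 * (H m * V m)))).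
  by apply: ler_sum => m _; apply: fiber_sum_sqr_le.
by rewrite big_split /= -!mulr_sumr -sq; have := sum_axes_le; lra.
Qed.

End Energy.
End Plane.

(** * The real-valued modulus of a complex number *)

Section Modulus.
Variable R : realType.
Implicit Types z : R[i].

Lemma real_cnorm z : (cnorm z)%:C = `|z|.
Proof. by rewrite /cnorm normc_def. Qed.

Lemma cnorm_ge0 z : 0 <= cnorm z.
Proof. by rewrite -ler0c real_cnorm. Qed.

Lemma cnormM z1 z2 : cnorm (z1 * z2) = cnorm z1 * cnorm z2.
Proof. by apply: complexI; rewrite rmorphM /= !real_cnorm normrM. Qed.

Lemma cnormX z k : cnorm (z ^+ k) = cnorm z ^+ k.
Proof. by apply: complexI; rewrite rmorphXn /= !real_cnorm normrX. Qed.

Lemma cnorm_nat k : cnorm (k%:R : R[i]) = k%:R.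
Proof. by apply: complexI; rewrite real_cnorm normr_nat rmorph_nat. Qed.

Lemma cnormV z : cnorm z^-1 = (cnorm z)^-1.
Proof. by apply: complexI; rewrite fmorphV /= !real_cnorm normfV. Qed.

Lemma cnorm_eq0 z : (cnorm z == 0) = (z == 0).
Proof. by rewrite -(inj_eq (@complexI R)) real_cnorm normr_eq0. Qed.

Lemma cnorm_sum (I : finType) (P : pred I) (f : I -> R[i]) :
  cnorm (\sum_(i | P i) f i) <= \sum_(i | P i) cnorm (f i).
Proof.
rewrite -lecR real_cnorm rmorph_sum /=.
by rewrite (eq_bigr _ (fun i _ => real_cnorm (f i))); apply: ler_norm_sum.
Qed.

Lemma sqr_cnorm z : (cnorm z ^+ 2)%:C = z * z^*%R.
Proof. by rewrite rmorphXn /= real_cnorm normCK. Qed.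
End Modulus.

(** * Orthogonality of additive characters and Parseval's identity *)

Section Characters.
Variable R : realType.

Lemma sum_character (V : finZmodType) (psi : V -> R[i]) :
    (forall x y, psi (x + y) = psi x * psi y) ->
  (exists x, psi x != 1) -> \sum_x psi x = 0.
Proof.
move=> psiD [x0 psi_x0]; have /eqP : \sum_x psi x = psi x0 * \sum_x psi x.
  by rewrite mulr_sumr [LHS](reindex_inj (addrI x0)); apply: eq_bigr.
rewrite -subr_eq0 -[X in X - _]mul1r -mulrBl mulf_eq0 subr_eq0 eq_sym.
by rewrite (negPf psi_x0) => /eqP.
Qed.

Variables (F : finFieldType) (e : F -> R[i]).
Hypothesis e_char : nontrivial_additive_character e.

Lemma characterD x y : e (x + y) = e x * e y.
Proof. by case: e_char. Qed.

Lemma character_neq0 x : e x != 0.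
Proof. by case: e_char => _ /(_ x) e1 _; rewrite -cnorm_eq0 e1 oner_eq0. Qed.

Lemma character0 : e 0 = 1.
Proof. by apply: (mulfI (character_neq0 0)); rewrite -characterD addr0 mulr1. Qed.

Lemma conj_character x : (e x)^*%R = e (- x).
Proof.
apply: (mulfI (character_neq0 x)); rewrite -sqr_cnorm -characterD subrr character0.
by case: e_char => _ -> _; rewrite expr1n.
Qed.

Lemma dotDr d (x y z : 'rV[F]_d) : dot x (y + z) = dot x y + dot x z.
Proof. by rewrite /dot -big_split; apply: eq_bigr => i _; rewrite mxE mulrDr. Qed.

Lemma dotDl d (x y z : 'rV[F]_d) : dot (x + y) z = dot x z + dot y z.
Proof. by rewrite /dot -big_split; apply: eq_bigr => i _; rewrite mxE mulrDl. Qed.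

Lemma dotNr d (x y : 'rV[F]_d) : dot x (- y) = - dot x y.
Proof. by rewrite /dot -sumrN; apply: eq_bigr => i _; rewrite mxE mulrN. Qed.

Lemma sum_character_dot d (v : 'rV[F]_d) :
  \sum_x e (dot x v) = (#|F| ^ d)%:R *+ (v == 0).
Proof.
have [->|v_neq0] := eqVneq v 0.
  rewrite (eq_bigr (fun=> 1)) => [|x _].
    by rewrite sumr_const card_mx mul1n.
  by rewrite /dot big1 ?character0 // => i _; rewrite mxE mulr0.
apply: (@sum_character ('rV[F]_d : finZmodType)) => [x y|].
  by rewrite dotDl characterD.
case: e_char => _ _ [y ey]; have /rV0Pn[i vi] := v_neq0.
(* The multiple of a basis vector whose product with [v] is [y], a point where [e] differs from
   1. *)
exists ((y / v 0 i) *: delta_mx 0 i).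
rewrite /dot (bigD1 i) //= big1 ?addr0 => [|j ji].
  by rewrite !mxE !eqxx mulr1 divfK.
by rewrite !mxE eqxx (negPf ji) mulr0 mul0r.
Qed.

(** Distinct frequencies [v i] make every off-diagonal term a full sum of a nontrivial character,
    which vanishes. *)
Lemma parseval d (I : finType) (v : I -> 'rV[F]_d) (a : I -> R[i]) :
    injective v ->
  \sum_x cnorm (\sum_i a i * e (dot x (v i))) ^+ 2 =
  (#|F| ^ d)%:R * \sum_i cnorm (a i) ^+ 2.
Proof.
move=> v_inj; apply: complexI; rewrite rmorphM rmorph_nat !rmorph_sum /= mulr_sumr.
under eq_bigr => x _ do rewrite sqr_cnorm rmorph_sum mulr_suml.
rewrite exchange_big; apply: eq_bigr => i _ /=.
under eq_bigr => x _ do rewrite mulr_sumr.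
rewrite exchange_big (bigD1 i) //= [X in _ + X]big1 => [|j ji].
  rewrite addr0 sqr_cnorm.
  rewrite (eq_bigr (fun=> a i * (a i)^*%R)) => [|x _].
    by rewrite sumr_const card_mx mul1n mulr_natl.
  by rewrite rmorphM /= mulrACA conj_character -characterD subrr character0 mulr1.
rewrite (eq_bigr (fun x => a i * (a j)^*%R * e (dot x (v i - v j)))) => [|x _].
  by rewrite -mulr_sumr sum_character_dot subr_eq0 (inj_eq v_inj) eq_sym (negPf ji) mulr0.
by rewrite rmorphM /= mulrACA conj_character -characterD dotDr dotNr.
Qed.

End Characters.

Lemma root_powR (R : realType) (x : R) k : (0 < k)%N -> 0 <= x ->
  (x `^ k%:R^-1) ^+ k = x.
Proof.
move=> k0 x0; rewrite -powR_mulrn ?powR_ge0 // -powRrM mulVf ?powRr1 //.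
by rewrite pnatr_eq0 -lt0n.
Qed.

(** * The paraboloid in null coordinates, and both norms expressed there *)

Section NullCoordinates.
Variables (R : realType) (F : finFieldType) (e : F -> R[i]) (w : F).
Hypotheses (two_neq0 : 2 != 0 :> F) (w2 : w ^+ 2 = -1).
Hypothesis e_char : nontrivial_additive_character e.
Implicit Types (m u v : F * F) (phi : F * F -> R[i]).
Let q : R := #|F|%:R.

(** Both basis vectors are isotropic when [w ^+ 2 = -1], so only the cross term of the quadratic
    form survives. *)
Definition null_vec u : 'rV[F]_2 := u.1 *: vec2 1 w + u.2 *: vec2 1 (- w).

Definition surface_pt u : {xi | xi \in paraboloid F} :=
  exist _ (paraboloid_pt (null_vec u)) (paraboloid_ptP (null_vec u)).

Definition surface_coord (f : sfun R (paraboloid F)) u := f (surface_pt u).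

Lemma null_basis_neq0 : w != 0.
Proof.
by apply/eqP => w0; move/eqP: w2; rewrite w0 expr0n eq_sym oppr_eq0 oner_eq0.
Qed.

Lemma null_vecE u : (null_vec u 0 0 = u.1 + u.2) * (null_vec u 0 1 = w * (u.1 - u.2)).
Proof. by split; rewrite !mxE /=; ring. Qed.

Lemma null_vecD u v : null_vec (u + v) = null_vec u + null_vec v.
Proof. by rewrite /null_vec /= !scalerDl addrACA. Qed.

Lemma dot_null_vec u : dot (null_vec u) (null_vec u) = 4 * (u.1 * u.2).
Proof.
rewrite /dot !big_ord_recl big_ord0 addr0 (_ : lift _ _ = 1); last exact: val_inj.
rewrite !null_vecE; set a := u.1; set b := u.2.
have -> : w * (a - b) * (w * (a - b)) = w ^+ 2 * (a - b) ^+ 2 by ring.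
by rewrite w2; ring.
Qed.

Lemma null_vec_bij : bijective null_vec.
Proof.
exists (fun xi : 'rV[F]_2 => ((xi 0 0 + xi 0 1 / w) / 2, (xi 0 0 - xi 0 1 / w) / 2)) => [[a b]|xi].
  by rewrite !null_vecE /=; congr (_, _); field; rewrite two_neq0 null_basis_neq0.
apply/rowP => i; have [->|->] : i = 0 \/ i = 1.
    by case: i => [[|[|i]]] //= ?; [left|right]; apply: val_inj.
  all: rewrite null_vecE /=; field;
  rewrite ?two_neq0 ?null_basis_neq0 //.
Qed.

Lemma surface_pt_bij : bijective surface_pt.
Proof.
have [co coK Kco] := null_vec_bij.
exists (fun xi => co (lsubmx (val xi))) => [u|[v v_in]].
  by rewrite /= /paraboloid_pt row_mxKl coK.
apply: val_inj; rewrite /= Kco /paraboloid_pt -[RHS]hsubmxK; congr row_mx.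
by apply/rowP => i; move: v_in; rewrite inE ord1 !mxE => /eqP ->.
Qed.

Lemma sum_surface (V : nmodType) (h : {xi | xi \in paraboloid F} -> V) :
  \sum_xi h xi = \sum_u h (surface_pt u).
Proof. exact: (reindex surface_pt (onW_bij _ surface_pt_bij)). Qed.

Lemma card_paraboloid : #|paraboloid F| = (#|F| ^ 2)%N.
Proof.
by rewrite -card_sig -(bij_eq_card surface_pt_bij) card_prod expnS expn1.
Qed.

(* A chord of the surface is recorded by its midpoint [m] and its half-difference
   [u]; the sum of its endpoints then depends only on [m] and [u.1 * u.2]. *)
Definition energy phi : R :=
  \sum_(m : F * F) \sum_k
    cnorm (\sum_(u | u.1 * u.2 == k) phi (m + u) * phi (m - u)) ^+ 2.

(** The factor 8 comes from adding [4 * (m + u).1 * (m + u).2] and [4 * (m - u).1 * (m - u).2], in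
    which the mixed terms cancel. *)
Definition pair_sum (mk : (F * F) * F) : 'rV[F]_(2 + 1) :=
  row_mx (null_vec mk.1 + null_vec mk.1)
    (\row_(j < 1) (8 * (mk.1.1 * mk.1.2 + mk.2))).

Lemma pair_sumE m u :
  paraboloid_pt (null_vec (m + u)) + paraboloid_pt (null_vec (m - u)) =
  pair_sum (m, u.1 * u.2).
Proof.
rewrite /paraboloid_pt /pair_sum add_row_mx -!null_vecD /=; congr row_mx.
  by congr null_vec; rewrite addrACA subrr addr0.
apply/rowP => j; rewrite !mxE !dot_null_vec /=; ring.
Qed.

(** This is the distinctness of frequencies that [parseval] requires of the squared extension. *)
Lemma pair_sum_inj : injective pair_sum.
Proof.
have eight_neq0 : 8 != 0 :> F by rewrite (natrX _ 2 3) expf_neq0.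
move=> [m k] [m' k'] /eq_row_mx[/=]; rewrite -!null_vecD => /(bij_inj null_vec_bij).
case: m m' => [a b] [a' b'] [/(double_inj two_neq0) <- /(double_inj two_neq0) <-].
by move=> /rowP /(_ 0); rewrite !mxE /= => /(mulfI eight_neq0) /addrI ->.
Qed.

Lemma extension_surface f x :
  extension e f x = q%:C ^- 2 * \sum_u surface_coord f u *
    e (dot x (paraboloid_pt (null_vec u))).
Proof.
by rewrite /extension sum_surface card_paraboloid natrX rmorph_nat.
Qed.

Lemma sqr_extension_sum phi x :
  (\sum_u phi u * e (dot x (paraboloid_pt (null_vec u)))) ^+ 2 =
  \sum_(mk : (F * F) * F) (\sum_(u | u.1 * u.2 == mk.2) phi (mk.1 + u) * phi (mk.1 - u)) *
     e (dot x (pair_sum mk)).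
Proof.
rewrite expr2 mulr_suml; under eq_bigr do rewrite mulr_sumr.
rewrite (sum_midpoint two_neq0) -(pair_bigA _ (fun m k =>
  (\sum_(u | u.1 * u.2 == k) phi (m + u) * phi (m - u)) * e (dot x (pair_sum (m, k))))) /=.
apply: eq_bigr => m _; rewrite (partition_big (fun u => u.1 * u.2) predT) //=.
apply: eq_bigr => k _; rewrite mulr_suml; apply: eq_bigr => u /eqP <-.
by rewrite -pair_sumE dotDr (characterD e_char) mulrACA.
Qed.

(** The normalization [q ^- 2] enters to the fourth power, and Parseval on the squared extension in
    dimension 3 returns [q ^+ 3]. *)
Lemma Lnorm_extension f :
  Lnorm_space 4 (extension e f) ^+ 4 = q ^- 5 * energy (surface_coord f).
Proof.
rewrite /Lnorm_space root_powR //; last by apply: sumr_ge0 => x _; apply: powR_ge0.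
rewrite (eq_bigr (fun x => q ^- 8 * cnorm (\sum_(mk : (F * F) * F)
   (\sum_(u | u.1 * u.2 == mk.2) surface_coord f (mk.1 + u) * surface_coord f (mk.1 - u)) *
     e (dot x (pair_sum mk))) ^+ 2)) => [|x _].
  rewrite -mulr_sumr (parseval e_char _ pair_sum_inj).
  rewrite /energy pair_bigA /= mulrA natrX -/q; congr (_ * _).
  have q0 : q != 0 by rewrite pnatr_eq0 -lt0n; apply/card_gt0P; exists 0.
  by field.
rewrite powR_mulrn ?cnorm_ge0 // extension_surface -sqr_extension_sum.
rewrite cnormX cnormM -exprM exprMn cnormV cnormX /q rmorph_nat cnorm_nat.
by rewrite exprVn -exprM.
Qed.

Lemma Lnorm_paraboloid (f : sfun R (paraboloid F)) :
  Lnorm_surface 2 f ^+ 4 = q ^- 4 * (\sum_u cnorm (surface_coord f u) ^+ 2) ^+ 2.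
Proof.
rewrite /Lnorm_surface -[4%N]/(2 * 2)%N exprM root_powR //; last first.
  apply: mulr_ge0; first by rewrite invr_ge0.
  by apply: sumr_ge0 => x _; apply: powR_ge0.
rewrite card_paraboloid natrX exprMn exprVn -exprM sum_surface; congr (_ * _ ^+ 2).
by apply: eq_bigr => u _; rewrite powR_mulrn ?cnorm_ge0.
Qed.

End NullCoordinates.

(** * The sharp energy bound and its equality case *)

Section Extremizers.
Variables (R : realType) (F : finFieldType).
Hypothesis two_neq0 : 2 != 0 :> F.
Implicit Types (m u v : F * F) (phi : F * F -> R[i]).
Let q : R := #|F|%:R.

Let q_gt0 : 0 < q.
Proof. by rewrite ltr0n; apply/card_gt0P; exists 0. Qed.

Let q_neq0 : q != 0. Proof. exact: lt0r_neq0. Qed.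

Definition hyperbola_invariant phi := forall m u v,
  u.1 * u.2 = v.1 * v.2 -> phi (m + u) * phi (m - u) = phi (m + v) * phi (m - v).

Let modulus_energy phi := \sum_(m : F * F) \sum_k
  (\sum_(u | u.1 * u.2 == k) cnorm (phi (m + u)) * cnorm (phi (m - u))) ^+ 2.

Let fiber_sum_le phi m k :
  cnorm (\sum_(u | u.1 * u.2 == k) phi (m + u) * phi (m - u)) ^+ 2 <=
  (\sum_(u | u.1 * u.2 == k) cnorm (phi (m + u)) * cnorm (phi (m - u))) ^+ 2.
Proof.
apply: lerXn2r; rewrite ?nnegrE ?cnorm_ge0 //.
  by apply: sumr_ge0 => u _; rewrite mulr_ge0 ?cnorm_ge0.
rewrite -(eq_bigr _ (fun u _ => cnormM _ _)); exact: cnorm_sum.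
Qed.

Let sum_fourth_ge phi :
  (\sum_u cnorm (phi u) ^+ 2) ^+ 2 <= q ^+ 2 * \sum_u cnorm (phi u) ^+ 4.
Proof.
apply: le_trans (sqr_sum_le _ _) _.
rewrite card_prod natrM -expr2 -/q ler_wpM2l ?sqr_ge0 //.
by apply: ler_sum => u _; rewrite -exprM.
Qed.

Let modulus_energy_le phi :
  modulus_energy phi + q * (\sum_u cnorm (phi u) ^+ 4) <=
  (q + 1) * (\sum_u cnorm (phi u) ^+ 2) ^+ 2.
Proof. by apply: (energy_le two_neq0) => u; apply: cnorm_ge0. Qed.

Let energy_le_modulus phi : energy phi <= modulus_energy phi.
Proof. by apply: ler_sum => m _; apply: ler_sum => k _; apply: fiber_sum_le. Qed.

Let scaled_fourth_ge phi :
  q^-1 * (\sum_u cnorm (phi u) ^+ 2) ^+ 2 <= q * \sum_u cnorm (phi u) ^+ 4.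
Proof.
rewrite -(ler_pM2l q_gt0) mulrA divff // mul1r mulrA -expr2; exact: sum_fourth_ge.
Qed.

Lemma energy_sharp phi :
  energy phi <= (q + 1 - q^-1) * (\sum_u cnorm (phi u) ^+ 2) ^+ 2.
Proof.
have := energy_le_modulus phi; have := modulus_energy_le phi.
by have := scaled_fourth_ge phi; lra.
Qed.

(** Equality must hold in every link of the chain behind [energy_sharp], in particular in
    Cauchy-Schwarz between the second and fourth powers of the modulus. *)
Lemma energy_eq_const phi :
    energy phi = (q + 1 - q^-1) * (\sum_u cnorm (phi u) ^+ 2) ^+ 2 ->
  forall u v, cnorm (phi u) = cnorm (phi v).
Proof.
move=> E u v.
have/eqP : cnorm (phi u) ^+ 2 = cnorm (phi v) ^+ 2.
  apply: (@sqr_sum_eq_const _ _ (fun u => cnorm (phi u) ^+ 2)).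
  apply/eqP; rewrite eq_le sqr_sum_le /= card_prod natrM -/q.
  rewrite (eq_bigr (fun u => cnorm (phi u) ^+ 4)) => [|x _]; last by rewrite -exprM.
  rewrite -mulrA -(ler_pM2l (_ : 0 < q^-1)) ?invr_gt0 // mulKf //.
  have := energy_le_modulus phi; have := modulus_energy_le phi.
  by rewrite E; lra.
by rewrite eqrXn2 ?cnorm_ge0 // => /eqP.
Qed.

(** Equality also forces equality in the triangle inequality on each fibre, so the summands share a
    phase; their moduli agree already. *)
Lemma energy_eq_invariant phi :
    energy phi = (q + 1 - q^-1) * (\sum_u cnorm (phi u) ^+ 2) ^+ 2 ->
  hyperbola_invariant phi.
Proof.
move=> E; have phi_const := energy_eq_const E.
have EM : modulus_energy phi = energy phi.
  apply/eqP; rewrite eq_le energy_le_modulus andbT E.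
  by have := modulus_energy_le phi; have := scaled_fourth_ge phi; lra.
have fiber_eq m k :
    (\sum_(u | u.1 * u.2 == k) cnorm (phi (m + u)) * cnorm (phi (m - u))) ^+ 2 =
    cnorm (\sum_(u | u.1 * u.2 == k) phi (m + u) * phi (m - u)) ^+ 2.
  (* The fibrewise gaps are nonnegative and sum to zero, so each one vanishes. *)
  move/eqP: EM; rewrite -subr_eq0 -sumrB psumr_eq0 => [|m' _]; last first.
    by rewrite subr_ge0; apply: ler_sum => k' _; apply: fiber_sum_le.
  move=> /allP /(_ m (mem_index_enum m)) /=.
  rewrite -sumrB psumr_eq0 => [|k' _]; last by rewrite subr_ge0 fiber_sum_le.
  by move=> /allP /(_ k (mem_index_enum k)) /=; rewrite subr_eq0 => /eqP.
move=> m u v uv; move/eqP: (fiber_eq m (v.1 * v.2)).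
rewrite eqrXn2 ?cnorm_ge0 //; last by apply: sumr_ge0 => x _; rewrite mulr_ge0 ?cnorm_ge0.
rewrite -(eq_bigr _ (fun u _ => cnormM _ _)) => /eqP /(congr1 (real_complex R)).
(* The equality case of the triangle inequality yields a common phase [t]. *)
rewrite real_cnorm rmorph_sum (eq_bigr _ (fun u _ => real_cnorm _)) => /esym /normC_sum_eq.
case=> t _ phase; rewrite [LHS]phase ?uv // [RHS]phase //; congr (_ * _).
by rewrite -!real_cnorm !cnormM !(phi_const _ 0).
Qed.

Lemma card_hyperbola_nonzero (k : F) : k != 0 ->
  \sum_(u : F * F | u.1 * u.2 == k) 1 = q - 1.
Proof. by move=> k0; rewrite sum_hyperbola // sumr_const natr_card_nonzero. Qed.

Lemma card_hyperbola_zero : \sum_(u : F * F | u.1 * u.2 == 0) 1 = 2 * q - 1.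
Proof. by rewrite sum_cross !sumr_const natr_card_nonzero -/q; ring. Qed.

(** All summands in a fibre coincide, so only fibre sizes matter: [(q - 1) ^+ 3 + (2 * q - 1) ^+ 2 =
    q ^+ 2 * (q + 1 - q^-1)]. *)
Lemma energy_invariant phi c :
    (forall u, cnorm (phi u) = c) -> hyperbola_invariant phi ->
  energy phi = (q + 1 - q^-1) * (\sum_u cnorm (phi u) ^+ 2) ^+ 2.
Proof.
move=> phi_c phi_inv.
have fiber m k : cnorm (\sum_(u | u.1 * u.2 == k) phi (m + u) * phi (m - u)) ^+ 2 =
    (\sum_(u : F * F | u.1 * u.2 == k) 1) ^+ 2 * c ^+ 4.
  (* The point [(k, 1)] represents the fibre over [k], including the cross [k = 0]. *)
  rewrite (eq_bigr (fun=> phi (m + (k, 1)) * phi (m - (k, 1)))) => [|u /eqP uk].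
    rewrite !sumr_const -mulr_natl cnormM cnorm_nat cnormM !phi_c; ring.
  by apply: phi_inv; rewrite /= mulr1.
rewrite /energy; under eq_bigr do rewrite (eq_bigr _ (fun k _ => fiber _ k)).
rewrite sumr_const (bigD1 0) //= card_hyperbola_zero.
rewrite (eq_bigr (fun=> (q - 1) ^+ 2 * c ^+ 4)) => [|k k0]; last first.
  by rewrite card_hyperbola_nonzero.
rewrite sumr_const -[_ *+ #|_|]mulr_natl natr_card_nonzero -/q.
under eq_bigr do rewrite phi_c.
rewrite sumr_const card_prod -[LHS]mulr_natl -[c ^+ 2 *+ _]mulr_natl natrM -/q; field; exact: q_neq0.
Qed.

End Extremizers.

(** * The functional equation and its solutions *)

Section HyperbolaInvariant.
Variables (R : realType) (F : finFieldType) (phi : F * F -> R[i]).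
Hypothesis two_neq0 : 2 != 0 :> F.
Hypothesis phi_neq0 : forall u, phi u != 0.
Hypothesis phi_inv : hyperbola_invariant phi.

(** Horizontal half-differences all lie on the cross [u.1 * u.2 = 0], so two horizontal chords with
    the same midpoint have equal endpoint products. *)
Lemma invariant_line1 x y z : phi (x + y, z) * phi (0, z) = phi (x, z) * phi (y, z).
Proof.
have := @phi_inv ((x + y) / 2, z) ((x + y) / 2, 0) ((x - y) / 2, 0).
rewrite /= !mulr0 => /(_ erefl); congr (phi _ * phi _ = phi _ * phi _);
  by congr (_, _); rewrite /= ?addr0 ?subr0 //; field.
Qed.

Lemma invariant_line2 x y z : phi (z, x + y) * phi (z, 0) = phi (z, x) * phi (z, y).
Proof.
have := @phi_inv (z, (x + y) / 2) (0, (x + y) / 2) (0, (x - y) / 2).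
rewrite /= !mul0r => /(_ erefl); congr (phi _ * phi _ = phi _ * phi _);
  by congr (_, _); rewrite /= ?addr0 ?subr0 //; field.
Qed.

Lemma invariant_factor : exists alpha beta gamma : F -> R[i],
  [/\ {morph alpha : x y / x + y >-> x * y}, {morph beta : x y / x + y >-> x * y},
      {morph gamma : x y / x + y >-> x * y}
    & forall x y, phi (x, y) = phi (0, 0) * (alpha x * beta y * gamma (x * y))].
Proof.
(* Dividing out the restrictions to both axes leaves a function [b] that is multiplicative in each
   variable separately. *)
pose b x y := phi (x, y) * phi (0, 0) / (phi (x, 0) * phi (0, y)).
pose alpha x := phi (x, 0) / phi (0, 0); pose beta y := phi (0, y) / phi (0, 0).
have nz := phi_neq0.
have alphaD : {morph alpha : x y / x + y >-> x * y}.
  by move=> x y; rewrite /alpha mulrACA -invariant_line1; field; rewrite nz.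
have betaD : {morph beta : x y / x + y >-> x * y}.
  by move=> x y; rewrite /beta mulrACA -invariant_line2; field; rewrite nz.
have solve1 x y z : phi (x + y, z) = phi (x, z) * phi (y, z) / phi (0, z).
  by rewrite -invariant_line1 mulfK.
have solve2 x y z : phi (z, x + y) = phi (z, x) * phi (z, y) / phi (z, 0).
  by rewrite -invariant_line2 mulfK.
have bDl y : {morph b^~ y : x x' / x + x' >-> x * x'}.
  by move=> x x'; rewrite /b !solve1; field; rewrite !nz.
have bDr x : {morph b x : y y' / y + y' >-> y * y'}.
  by move=> y y'; rewrite /b !solve2; field; rewrite !nz.
have b0l y : b 0 y = 1 by rewrite /b; field; rewrite !nz.
have b0r x : b x 0 = 1 by rewrite /b; field; rewrite !nz.
have phiE x y : phi (x, y) = phi (0, 0) * (alpha x * beta y * b x y).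
  by rewrite /alpha /beta /b; field; rewrite !nz.
have alphaN x : alpha x * alpha (- x) = 1 by rewrite -alphaD subrr /alpha divff.
have betaN x : beta x * beta (- x) = 1 by rewrite -betaD subrr /beta divff.
have bNN x y : b (- x) (- y) = b x y.
  have e1 : b x y * b (- x) y = 1 by rewrite -bDl subrr.
  have e2 : b (- x) y * b (- x) (- y) = 1 by rewrite -bDr subrr.
  by rewrite -[LHS]mul1r -e1 -mulrA e2 mulr1.
(* For chords centred at the origin, the factors [alpha] and [beta] cancel between antipodal
   endpoints and the two values of [b] agree. *)
have sqr_b x y x' y' : x * y = x' * y' -> b x y ^+ 2 = b x' y' ^+ 2.
  have E z t : phi (z, t) * phi (- z, - t) = phi (0, 0) ^+ 2 * b z t ^+ 2.
    rewrite (phiE z t) (phiE (- z)) bNN; transitivity (phi (0, 0) ^+ 2 * (alpha z * alpha (- z)) *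
      (beta t * beta (- t)) * b z t ^+ 2); first by ring.
    by rewrite alphaN betaN !mulr1.
  move=> xy; have := @phi_inv 0 (x, y) (x', y') xy; rewrite !add0r E E.
  by move/mulfI; apply; rewrite expf_neq0.
(* [sqr_b] only controls squares; halving [x] turns [b x y] into a square. *)
have bE x y : b x y = b (x * y) 1.
  have half (z : F) : z = z / 2 + z / 2 by field.
  rewrite [in LHS](half x) bDl -expr2 (sqr_b _ _ (x * y / 2) 1); last by field.
  by rewrite expr2 -(bDl 1) -half.
exists alpha, beta, (b^~ 1); split=> // x y; by rewrite (phiE x y) bE.
Qed.

End HyperbolaInvariant.

(** * Self-duality of the additive group of the field *)

Section Duality.
Variables (R : realType) (F : finFieldType) (psi : F -> R[i]).
Hypothesis psi_char : nontrivial_additive_character psi.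

Lemma sum_character_mul (x : F) : x != 0 -> \sum_a psi (a * x) = 0.
Proof.
move=> x0; apply: (@sum_character R (F : finZmodType) (fun a => psi (a * x))) => [a b|].
  by rewrite mulrDl (characterD psi_char).
by case: psi_char => _ _ [y psi_y]; exists (y / x); rewrite divfK.
Qed.

(** Otherwise [chi] is orthogonal to every [psi (a * x)]. Summing these relations over [a] kills all
    terms but [x = 0] and leaves [#|F| * chi 0 = 0], a contradiction. *)
Lemma character_dual (chi : F -> R[i]) :
    {morph chi : x y / x + y >-> x * y} -> chi 0 != 0 ->
  exists a, forall x, chi x = psi (a * x).
Proof.
move=> chiD chi0; apply: contrapT => no.
have sum0 a : \sum_x chi x * psi (- (a * x)) = 0.
  apply: (@sum_character R (F : finZmodType) (fun x => chi x * psi (- (a * x)))) => [x y|].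
    by rewrite mulrDr opprD (characterD psi_char) chiD mulrACA.
  apply: contrapT => triv; apply: no; exists a => x.
  apply: (mulIf (character_neq0 psi_char (- (a * x)))).
  rewrite -(characterD psi_char) subrr (character0 psi_char).
  by apply: contrapT => /eqP nx; apply: triv; exists x.
have : \sum_a \sum_x chi x * psi (- (a * x)) = 0 by rewrite big1.
rewrite exchange_big (bigD1 0) //= [X in _ + X]big1 => [|x x0]; last first.
  rewrite -mulr_sumr; under eq_bigr do rewrite -mulrN.
  by rewrite sum_character_mul ?mulr0 // oppr_eq0.
under eq_bigr do rewrite mulr0 oppr0 (character0 psi_char) mulr1.
rewrite addr0 sumr_const -mulr_natl => /eqP; rewrite mulf_eq0 (negPf chi0) orbF.
rewrite pnatr_eq0 => /eqP F0.
by have := card0_eq F0 0.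
Qed.

End Duality.

(** * The trace character as a nontrivial additive character *)

Section TraceCharacter.
Variables (R : realType) (F : finFieldType) (p n : nat).
Hypotheses (p_prime : prime p) (p_odd : odd p) (n_gt0 : (0 < n)%N).
Hypothesis cardF : #|F| = (p ^ n)%N.

Let pcharF : p \in [pchar F] := card_finPcharP cardF p_prime.

Lemma cexpD (z1 z2 : R[i]) : cexp (z1 + z2) = cexp z1 * cexp z2.
Proof.
case: z1 z2 => [a b] [c d]; rewrite /cexp /= expRD cosD sinD; simpc.
by congr (_ +i* _); ring.
Qed.

Lemma cexp0 : cexp (0 : R[i]) = 1.
Proof. by rewrite /cexp /= expR0 cos0 sin0; simpc. Qed.

Lemma cexpMn (z : R[i]) k : cexp (k%:R * z) = cexp z ^+ k.
Proof.
elim: k => [|k IH]; first by rewrite mul0r cexp0 expr0.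
by rewrite -natr1 mulrDl mul1r cexpD IH exprSr.
Qed.

Let omega : R[i] := cexp (2 * pi%:C * 'i%C / p%:R).

Let imag_arg (x : R) : 2 * pi%:C * 'i%C * x%:C = 0 +i* (2 * pi * x).
Proof. by rewrite -[2](rmorph_nat (real_complex R) 2) -!rmorphM /=; simpc. Qed.

Let omegaE : omega = cos (2 * pi / p%:R) +i* sin (2 * pi / p%:R).
Proof.
rewrite /omega -[p%:R](rmorph_nat (real_complex R) p) -fmorphV imag_arg.
by rewrite /cexp /= expR0; simpc.
Qed.

Let omega_exp : omega ^+ p = 1.
Proof.
have p0 : p%:R != 0 :> R[i] by rewrite pnatr_eq0 -lt0n prime_gt0.
rewrite /omega -cexpMn mulrC divfK // -[_ * _]mulr1 (imag_arg 1) mulr1 /cexp /= expR0.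
by rewrite (mulr_natl pi 2) cos2pi sin2pi; simpc.
Qed.

(** An odd prime is at least 3, so [2 * pi / p] lies strictly between 0 and [pi] and has positive
    sine. *)
Let omega_neq1 : omega != 1.
Proof.
have p3 : (2 < p)%N by case: p p_prime p_odd => [|[|[|]]].
have pi0 : 0 < pi :> R := pi_gt0 R.
rewrite omegaE eq_complex negb_and; apply/orP; right.
rewrite /= gt_eqF // sin_gt0_pi // divr_gt0 ?mulr_gt0 ?ltr0n ?prime_gt0 //=.
by rewrite ltr_pdivrMr ?ltr0n ?prime_gt0 // mulrC ltr_pM2l // ltr_nat.
Qed.

Let omega_natr (k l : nat) : k%:R = l%:R :> F -> omega ^+ k = omega ^+ l.
Proof.
wlog kl : k l / (k <= l)%N.
  by move=> H; case/orP: (leq_total k l) => ? E; [|symmetry]; apply: H.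
move=> /eqP; rewrite eq_sym -subr_eq0 -natrB // -(dvdn_pcharf pcharF) => /dvdnP[j lk].
by rewrite -(subnK kl) lk exprD mulnC exprM omega_exp expr1n mul1r.
Qed.

Definition trace_character (x : F) : R[i] :=
  cexp (2 * pi%:C * 'i%C * (trace p n x : nat)%:R / p%:R).

Let trace_characterE x : trace_character x = omega ^+ (trace p n x : nat).
Proof. by rewrite -cexpMn /trace_character; congr cexp; ring. Qed.

Let trace_sumD (x y : F) : \sum_(i < n) (x + y) ^+ (p ^ i) =
  \sum_(i < n) x ^+ (p ^ i) + \sum_(i < n) y ^+ (p ^ i).
Proof.
rewrite -big_split; apply: eq_bigr => i _ /=; elim: (i : nat) => [|k IH].
  by rewrite expn0 !expr1.
by rewrite expnSr !exprM IH -!(pFrobenius_autE pcharF) rmorphD.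
Qed.

Let trace_characterD x y :
  trace_character (x + y) = trace_character x * trace_character y.
Proof.
rewrite !trace_characterE -exprD; apply: omega_natr.
by rewrite natrD !(trace_natr p_prime cardF) trace_sumD.
Qed.

(** The trace is a polynomial of degree below [p ^ n = #|F|], nonzero because its coefficient of
    ['X] is 1; it cannot vanish on the whole field. *)
Let trace_sum_neq0 : exists x : F, \sum_(i < n) x ^+ (p ^ i) != 0.
Proof.
pose P : {poly F} := \sum_(i < n) 'X^(p ^ i).
have PE x : P.[x] = \sum_(i < n) x ^+ (p ^ i).
  by rewrite horner_sum; apply: eq_bigr => i _; rewrite hornerXn.
have P0 : P != 0.
  apply/eqP => /(congr1 (fun Q : {poly F} => Q`_1)); rewrite coef0 coef_sum.
  rewrite (bigD1 (Ordinal n_gt0)) //= big1 => [|i i0].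
    by rewrite coefXn expn0 addr0 => /eqP; rewrite oner_eq0.
  rewrite coefXn -{1}(expn0 p) eqn_exp2l ?prime_gt1 //.
  by case: eqP => // /esym i_0; case/eqP: i0; apply: val_inj.
apply: contrapT => no.
have : (size (enum F) < size P)%N.
  apply: max_poly_roots => //; last exact: enum_uniq.
  apply/allP => x _; rewrite rootE PE; apply: contrapT => nx; apply: no; exists x.
  exact/negP.
rewrite -cardE cardF ltnNge; apply/negP/negPn; apply: leq_trans (size_sum _ _ _) _.
by apply/bigmax_leqP => i _; rewrite size_polyXn ltn_exp2l ?prime_gt1.
Qed.

Lemma trace_character_nontrivial : nontrivial_additive_character trace_character.
Proof.
(* Values are [p]-th roots of unity, hence of modulus 1. *)
have char_nat x : trace_character x ^+ p = 1.
  by rewrite trace_characterE -exprM mulnC exprM omega_exp expr1n.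
split; first exact: trace_characterD.
  move=> x; have /eqP := congr1 (@cnorm R) (char_nat x).
  rewrite cnormX (cnorm_nat R 1).
  by rewrite pexpr_eq1 ?cnorm_ge0 ?prime_gt0 // => /eqP.
have [x x0] := trace_sum_neq0; set t := trace p n x.
have t0 : t != 0.
  by apply: contraNneq x0 => t0; rewrite -(trace_natr p_prime cardF) -/t t0.
(* Inverting the nonzero trace [t] in ['F_p] gives a multiple of [x] at which the character equals
   [omega]. *)
pose j : nat := t^-1.
exists (x *+ j).
have -> : trace_character (x *+ j) = trace_character x ^+ j.
  elim: j => [|k IH]; last by rewrite mulrS trace_characterD IH exprS.
  rewrite trace_characterE -[RHS](expr0 omega); apply: omega_natr.
  rewrite (trace_natr p_prime cardF) big1 // => i _.
  by rewrite expr0n expn_eq0 eqn0Ngt prime_gt0.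
rewrite trace_characterE -/t -exprM -(expr_mod _ omega_exp).
suff -> : (t * j %% p = 1)%N by rewrite expr1.
by have := congr1 val (mulfV t0); rewrite /= {3}Fp_cast.
Qed.

End TraceCharacter.

(** * The best constant, and maximizers as equality cases of the energy bound *)

Section SharpInequality.
Variables (R : realType) (F : finFieldType) (e : F -> R[i]) (w : F).
Hypotheses (two_neq0 : 2 != 0 :> F) (w2 : w ^+ 2 = -1).
Hypothesis e_char : nontrivial_additive_character e.
Let q : R := #|F|%:R.
Let C : R := 1 + 1 / q - 1 / q ^+ 2.

Let q_gt0 : 0 < q.
Proof. by rewrite ltr0n; apply/card_gt0P; exists 0. Qed.

Let q_neq0 : q != 0. Proof. exact: lt0r_neq0. Qed.

Let constant_mul (N : R) : C * (q ^- 4 * N) = q ^- 5 * ((q + 1 - q^-1) * N).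
Proof. by rewrite /C; field. Qed.

Lemma extension_sharp : extension_ineq_24 e (paraboloid F) C.
Proof.
move=> f; rewrite (Lnorm_extension two_neq0 w2 e_char) (Lnorm_paraboloid two_neq0 w2).
rewrite constant_mul ler_pM2l ?invr_gt0 ?exprn_gt0 //; exact: energy_sharp.
Qed.

Lemma extension_eqE (f : sfun R (paraboloid F)) :
  Lnorm_space 4 (extension e f) ^+ 4 = C * Lnorm_surface 2 f ^+ 4 <->
  energy (surface_coord w f) =
    (q + 1 - q^-1) * (\sum_u cnorm (surface_coord w f u) ^+ 2) ^+ 2.
Proof.
rewrite (Lnorm_extension two_neq0 w2 e_char) (Lnorm_paraboloid two_neq0 w2).
rewrite constant_mul; split=> [|-> //].
by apply/mulfI; rewrite invr_eq0 expf_neq0.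
Qed.

Lemma extension_best : best_constant_24 e (paraboloid F) C.
Proof.
split=> [|C' /(_ (fun=> 1))]; first exact: extension_sharp.
have cnorm1 : cnorm (1 : R[i]) = 1 by exact: (cnorm_nat R 1).
(* The constant function 1 is hyperbola invariant, so it attains equality with positive norm and
   rules out any smaller constant. *)
have /extension_eqE -> : energy (surface_coord w (fun=> 1 : R[i])) =
    (q + 1 - q^-1) * (\sum_u cnorm (surface_coord w (fun=> 1 : R[i]) u) ^+ 2) ^+ 2.
  exact: (@energy_invariant _ _ _ 1).
rewrite ler_pM2r // (Lnorm_paraboloid two_neq0 w2) mulr_gt0 ?invr_gt0 ?exprn_gt0 //.
rewrite (eq_bigr (fun=> 1)) => [|u _]; last by rewrite /surface_coord cnorm1 expr1n.
by rewrite sumr_const card_prod ltr0n muln_gt0 -(ltr0n R) q_gt0.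
Qed.

Lemma maximizerE (f : sfun R (paraboloid F)) :
  maximizer_24 e f <->
  (exists u, surface_coord w f u != 0) /\
  energy (surface_coord w f) =
    (q + 1 - q^-1) * (\sum_u cnorm (surface_coord w f u) ^+ 2) ^+ 2.
Proof.
rewrite -extension_eqE; split=> [[[xi f_xi] [C' [C'_ineq C'_best]]]|[[u f_u] E]].
  have -> : C' = C.
    apply/eqP; rewrite eq_le (C'_best _ extension_sharp).
    by case: extension_best => _ ->.
  split=> //; have [co _ coK] := surface_pt_bij two_neq0 w2.
  by exists (co xi); rewrite /surface_coord coK.
split; first by exists (surface_pt w u).
by exists C; first exact: extension_best.
Qed.

End SharpInequality.

Theorem theorem1p2 (R : realType) (F : finFieldType) (p n : nat)
    (e : F -> R[i]) (w : F)
    (p_prime : prime p) (p_odd : odd p) (n_gt0 : (0 < n)%N)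
    (cardF : #|F| = (p ^ n)%N) (q1mod4 : #|F| = 1 %[mod 4])
    (w2 : w ^+ 2 = -1) (e_char : nontrivial_additive_character e) :
  let q : R := #|F|%:R in
  best_constant_24 e (paraboloid F) (1 + 1 / q - 1 / q ^+ 2) /\
  forall f : sfun R (paraboloid F),
    maximizer_24 e f <->
    exists (lambda : R[i]) (a b c : F), lambda != 0 /\
      forall eta zeta : F,
        proj f (eta *: vec2 1 w + zeta *: vec2 1 (- w)) =
        lambda * cexp (2 * pi%:C * 'i%C *
          (trace p n (a * eta + b * zeta + c * eta * zeta) : nat)%:R / p%:R).
Proof.
have two_neq0 : 2 != 0 :> F.
  rewrite -(dvdn_pcharf (card_finPcharP cardF p_prime)).
  by rewrite dvdn_prime2 //; apply: contraTneq p_odd => ->.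
split; first exact: extension_best two_neq0 w2 e_char.
pose psi := @trace_character R F p n.
have psi_char : nontrivial_additive_character psi by exact: trace_character_nontrivial.
have psiD := characterD psi_char.
move=> f; rewrite (maximizerE two_neq0 w2 e_char); set phi := surface_coord w f.
split=> [[[u0 phi_u0] E]|[lambda [a [b [c [lambda0 fE]]]]]].
  have phi_neq0 u : phi u != 0 by rewrite -cnorm_eq0 (energy_eq_const two_neq0 E u u0) cnorm_eq0.
  have phi_inv := energy_eq_invariant two_neq0 E.
  have [alpha [beta [gamma [alphaD betaD gammaD phiE]]]] :=
    invariant_factor two_neq0 phi_neq0 phi_inv.
  (* Nonvanishing at the origin gives the nonzero values at 0 that [character_dual] needs for the
     three factors. *)
  have := phi_neq0 (0, 0); rewrite phiE mul0r !mulf_eq0 !negb_or -!andbA.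
  case/and4P => _ alpha0 beta0 gamma0.
  have [a alphaE] := character_dual psi_char alphaD alpha0.
  have [b betaE] := character_dual psi_char betaD beta0.
  have [c gammaE] := character_dual psi_char gammaD gamma0.
  exists (phi (0, 0)), a, b, c; split=> // eta zeta.
  have := phiE eta zeta; rewrite alphaE betaE gammaE -!psiD mulrA; exact.
have phiE u : phi u = lambda * psi (a * u.1 + b * u.2 + c * u.1 * u.2) by exact: fE.
split; first by exists 0; rewrite phiE mulf_neq0 ?(character_neq0 psi_char).
apply: (@energy_invariant _ _ _ (cnorm lambda)) => [u|m u v uv].
  by rewrite phiE cnormM; case: psi_char => _ -> _; rewrite mulr1.
rewrite !phiE [LHS]mulrACA [RHS]mulrACA -!psiD; congr (_ * psi _).
(* In the sum of the two phases the terms linear in [x] cancel, leaving only [m] and [x.1 * x.2]. *)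
have E x : a * (m + x).1 + b * (m + x).2 + c * (m + x).1 * (m + x).2 +
    (a * (m - x).1 + b * (m - x).2 + c * (m - x).1 * (m - x).2) =
    2 * (a * m.1 + b * m.2) + 2 * c * (m.1 * m.2 + x.1 * x.2).
  by case: m x => [m1 m2] [x1 x2] /=; ring.
by rewrite !E uv.
Qed.
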